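(* Let $k$ be a field, let $D$ be an oriented knot diagram with at least one crossing, let $\tau : (Q_D)_0 \to k\setminus\{0\}$ be a map, and let $\Lambda_{D,\tau} = kQ_D/I_\tau$ be the algebra of the diagram $D$ with respect to $\tau$. Let $n_D$ be the number of arrows of $Q_D$. Then $\Lambda_{D,\tau}$ is finite dimensional over $k$. Moreover, a $k$-basis of $\Lambda_{D,\tau}$ is given by the classes of the positive fundamental cycles $\gamma_e^+$ (one for each vertex $e$ of $Q_D$) together with the classes of the paths of $Q_D$ of length strictly less than $n_D$ (including the trivial paths) which are non-zero in $\Lambda_{D,\tau}$; these non-zero paths of length strictly less than $n_D$ are precisely the follow-up paths having strictly less than $n_D$ arrows.
   Context: Quivers and path algebras. A quiver $Q$ consists of finite sets $Q_0$ (vertices) and $Q_1$ (arrows) and maps $s,t:Q_1\to Q_0$ (source, target); loops and multiple arrows are allowed. The path algebra $kQ$ has as $k$-basis all oriented paths of $Q$, including the trivial (length $0$) paths given by the vertices; the product of two paths is their concatenation if it can be performed and $0$ otherwise. Paths are composed from right to left: $ba$ means first $a$, then $b$, with $t(a)=s(b)$. Knot diagrams. An oriented knot diagram $D$ is a regular projection of an oriented knot (one component) to the plane, with finitely many transversal double points (crossings), each with the information of which strand passes over and which passes under. Thus travelling once around $D$ along its orientation, one passes through each crossing exactly twice, once over and once under. A segment of $D$ is the part of the diagram followed, along the orientation, from one passage through a crossing to the next passage through a crossing (no crossing in between). The quiver $Q_D$ ($D$ with at least one crossing). Its vertices are the crossings of $D$. Each segment gives one arrow, from the crossing where the segment starts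 to the crossing where it ends. The source of an arrow is called positive (resp. negative) if the corresponding segment starts by over-crossing (resp. under-crossing) at that crossing; the target of an arrow is called positive (resp. negative) if the segment ends by over-crossing (resp. under-crossing). So each vertex $e$ is the source of exactly two arrows, one with positive and one with negative source, and the target of exactly two arrows, one with positive and one with negative target. Follow-up paths. A path of $Q_D$ is a follow-up path (made by following up the segments of the diagram) if for any two consecutive arrows $a$, then $b$, in it, the sign of the target of $a$ equals the sign of the source of $b$, i.e. the segment of $b$ is the successor of the segment of $a$ along the oriented diagram. Trivial paths and single arrows are follow-up paths. Cycles at a vertex $e$. $\alpha_e$ is the path from $e$ to $e$ that starts with the arrow with positive source $e$ and continues by browsing the oriented diagram until reaching the arrow with negative target $e$. $\beta_e$ is the path from $e$ to $e$ that starts with the arrow with negative source $e$ and continues by browsing the oriented diagram until reaching the arrow with positive target $e$. The positive fundamental cycle at $e$ is $\gamma_e^+=\beta_e\alpha_e$ and the negative fundamental cycle at $e$ is $\gamma_e^-=\alpha_e\beta_e$. The ideal $I_\tau$ is the two-sided ideal of $kQ_D$ generated by: (Type I) all paths $ba$ of length $2$ such that, at the middle vertex $e=t(a)=s(b)$, the sign of the target of $a$ differs from the sign of the source of $b$; (Type II) the elements $\alpha_e\beta_e-\tau(e)\,\beta_e\alpha_e$ for all vertices $e$. The algebra of the diagram $D$ with respect to $\tau$ is $\Lambda_{D,\tau}=kQ_D/I_\tau$. *)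

(* Defs.v *)
From HB Require Import structures.
From mathcomp Require Import all_boot all_order all_algebra.
From mathcomp Require Import finmap generic_quotient ring_quotient.
From mathcomp Require Import boolp classical_sets reals topology normedtype derive.
(* The notations of monalg clash with those of mathcomp-analysis. *)
From mathcomp Require Import -(notations) monalg.

Set Implicit Arguments.
Unset Strict Implicit.
Unset Printing Implicit Defensive.

Import Order.TTheory GRing.Theory Num.Theory.
Import numFieldNormedType.Exports.

Local Open Scope ring_scope.
Local Open Scope quotient_scope.

Section Bases.
Variables (k : fieldType) (V : lmodType k).

Definition finite_dimensional : Prop := exists n, inhabited (Vector.axiom n V).

(* A basis is a family, so distinct indices carry distinct vectors. *)
Definition is_basis (I : eqType) (b : I -> V) : Prop :=
  (forall (s : seq I) (c : I -> k),
      uniq s -> \sum_(i <- s) c i *: b i = 0 -> {in s, forall i, c i = 0})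
  /\ (forall v, exists (s : seq I) (c : I -> k), v = \sum_(i <- s) c i *: b i).

End Bases.

(* Elements of the two-sided ideal generated by S, for a possibly
   noncommutative ring with unit. *)
Section Ideals.
Variables (A : pzRingType) (S : set A).

Definition ideal_gen : {pred A} := fun x =>
  `[< exists (n : nat) (l g r : 'I_n -> A),
        (forall i, S (g i)) /\ x = \sum_(i < n) l i * g i * r i >].

Lemma ideal_gen0 : 0 \in ideal_gen.
Proof.
apply/asboolP; exists 0%N, (fun=> 0), (fun=> 0), (fun=> 0).
by split=> [[]//|]; rewrite big_ord0.
Qed.

Lemma ideal_genMl a x : x \in ideal_gen -> a * x \in ideal_gen.
Proof.
move=> /asboolP[n [l [g [r [Sg ->]]]]]; apply/asboolP.
exists n, (fun i => a * l i), g, r; split=> //.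
by rewrite mulr_sumr; apply: eq_bigr => i _; rewrite !mulrA.
Qed.

Lemma ideal_genMr a x : x \in ideal_gen -> x * a \in ideal_gen.
Proof.
move=> /asboolP[n [l [g [r [Sg ->]]]]]; apply/asboolP.
exists n, l, g, (fun i => r i * a); split=> //.
by rewrite mulr_suml; apply: eq_bigr => i _; rewrite !mulrA.
Qed.

Lemma ideal_genD x y :
  x \in ideal_gen -> y \in ideal_gen -> x + y \in ideal_gen.
Proof.
move=> /asboolP[n [l [g [r [Sg ->]]]]] /asboolP[m [l' [g' [r' [Sg' ->]]]]].
pose glue (u : 'I_n -> A) (v : 'I_m -> A) (i : 'I_(n + m)) :=
  match fintype.split i with inl j => u j | inr j => v j end.
apply/asboolP; exists (n + m)%N, (glue l l'), (glue g g'), (glue r r'); split.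
  by move=> i; rewrite /glue; case: fintype.split.
rewrite big_split_ord /=; congr (_ + _); apply: eq_bigr => i _; rewrite /glue.
  by rewrite (unsplitK (inl i)).
by rewrite (unsplitK (inr i)).
Qed.

Lemma ideal_gen_zmod : zmod_closed ideal_gen.
Proof.
split=> [|x y Ix Iy]; first exact: ideal_gen0.
by rewrite -mulN1r ideal_genD // ideal_genMl.
Qed.

HB.instance Definition _ := GRing.isZmodClosed.Build A ideal_gen ideal_gen_zmod.

End Ideals.

Record quiver := Quiver {
  vertex : finType;
  arrow : finType;
  src : arrow -> vertex;
  tgt : arrow -> vertex
}.
Arguments src {q}.
Arguments tgt {q}.

Section Paths.
Variable Q : quiver.

(* [composable v s]: the arrows s, listed in the order in which they are
   travelled, form an oriented path starting at v. *)
Fixpoint composable (v : vertex Q) (s : seq (arrow Q)) : bool :=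
  if s is a :: s' then (src a == v) && composable (tgt a) s' else true.

(* The starting vertex is recorded so as to have the trivial paths. *)
Record qpath := QPath {
  qpath_val : vertex Q * seq (arrow Q);
  qpath_valP : composable qpath_val.1 qpath_val.2
}.

HB.instance Definition _ := [isSub for qpath_val].
HB.instance Definition _ := [Countable of qpath by <:].

Definition psrc (p : qpath) : vertex Q := (qpath_val p).1.
Definition arrows (p : qpath) : seq (arrow Q) := (qpath_val p).2.
Definition ptgt (p : qpath) : vertex Q := last (psrc p) (map tgt (arrows p)).
Definition plength (p : qpath) : nat := size (arrows p).

Definition trivial_path (v : vertex Q) : qpath := @QPath (v, [::]) isT.

Lemma arrow_pathP (a : arrow Q) : composable (src a) [:: a].
Proof. by rewrite /= eqxx. Qed.

Definition arrow_path (a : arrow Q) : qpath := @QPath (src a, [:: a]) (arrow_pathP a).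

(* [pcomp p q] is "first q, then p"; [None] if p cannot follow q. *)
Definition pcomp (p q : qpath) : option qpath :=
  if ptgt q == psrc p then insub (psrc q, arrows q ++ arrows p) else None.

Lemma composable_cat v s1 s2 :
  composable v (s1 ++ s2) =
  composable v s1 && composable (last v (map tgt s1)) s2.
Proof. by elim: s1 v => //= a s IHs v; rewrite IHs andbA. Qed.

Lemma pcompP p q : ptgt q = psrc p ->
  {r | pcomp p q = Some r & qpath_val r = (psrc q, arrows q ++ arrows p)}.
Proof.
move=> e; rewrite /pcomp e eqxx; case: insubP => [r _ rE|]; first by exists r.
rewrite /= composable_cat -/(ptgt q) e.
by case: (p) (q) => [[? ?] /= pP] [[? ?] /= qP]; rewrite /psrc /arrows /= qP pP.
Qed.

Lemma ptgt_pcomp p q r : ptgt q = psrc p ->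
  qpath_val r = (psrc q, arrows q ++ arrows p) -> ptgt r = ptgt p.
Proof. by move=> e rE; rewrite /ptgt /psrc /arrows rE /= map_cat last_cat -/(ptgt q) e. Qed.

Lemma pcompA p q r :
  obind (pcomp p) (pcomp q r) = obind (fun pq => pcomp pq r) (pcomp p q).
Proof.
have [e1|n1] := eqVneq (ptgt r) (psrc q); last first.
  rewrite [pcomp q r]/pcomp (negPf n1) /=.
  have [e2|n2] := eqVneq (ptgt q) (psrc p); last by rewrite /pcomp (negPf n2).
  have [s -> sE] := pcompP e2.
  by rewrite /= /pcomp [psrc s]/psrc sE (negPf n1).
have [s sS sE] := pcompP e1; have st := ptgt_pcomp e1 sE.
rewrite sS /=; have [e2|n2] := eqVneq (ptgt q) (psrc p); last first.
  by rewrite /pcomp st (negPf n2).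
have [t tS tE] := pcompP e2; rewrite tS /=.
have [u -> uE] := pcompP (etrans st e2).
have [|v -> vE] := @pcompP t r; first by rewrite e1 [RHS]/psrc tE.
congr Some; apply: val_inj; rewrite /= uE vE.
by rewrite /psrc /arrows sE tE /= catA.
Qed.

Lemma pcomp1p p : pcomp (trivial_path (ptgt p)) p = Some p.
Proof.
have [//|r -> rE] := @pcompP (trivial_path (ptgt p)) p.
by congr Some; apply: val_inj; rewrite /= rE cats0; case: (p) => [[]].
Qed.

Lemma pcompp1 p : pcomp p (trivial_path (psrc p)) = Some p.
Proof.
have [//|r -> rE] := @pcompP p (trivial_path (psrc p)).
by congr Some; apply: val_inj; rewrite /= rE; case: (p) => [[]].
Qed.

End Paths.

(* The vector space kQ is the free k-module on the paths. *)
Definition path_algebra (k : fieldType) (Q : quiver) : Type := malg (qpath Q) k.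

HB.instance Definition _ (k : fieldType) (Q : quiver) :=
  GRing.Lmodule.on (path_algebra k Q).

(* Locked: unification must not unfold monalg's finitely supported functions. *)
HB.lock Definition pbasis (k : fieldType) (Q : quiver) (p : qpath Q) :
  path_algebra k Q := mkmalgU p 1.

Section PathAlgebra.
Variables (k : fieldType) (Q : quiver).
Local Notation kQ := (path_algebra k Q).
Local Notation pbasis := (@pbasis k Q).

Definition lin_ext (V : lmodType k) (f : qpath Q -> V) (x : kQ) : V :=
  \sum_(p <- msupp x) mcoeff p x *: f p.

Lemma lin_extw (V : lmodType k) (f : qpath Q -> V) (x : kQ) (s : {fset qpath Q}) :
  (msupp x `<=` s)%fset -> lin_ext f x = \sum_(p <- s) mcoeff p x *: f p.
Proof.
move=> sub; rewrite /lin_ext (big_fset_incl _ sub) // => p _ px.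
by rewrite mcoeff_outdom ?scale0r.
Qed.

Lemma mcoeff_pbasis p q : mcoeff q (pbasis p) = (p == q)%:R.
Proof. by rewrite pbasis.unlock mcoeffU. Qed.

Lemma lin_ext_basis (V : lmodType k) (f : qpath Q -> V) p : lin_ext f (pbasis p) = f p.
Proof.
rewrite pbasis.unlock (lin_extw f (msuppU_le (k := p))) big_seq_fset1.
by rewrite mcoeffUU scale1r.
Qed.

Lemma lin_ext_linear (V : lmodType k) (f : qpath Q -> V) : linear (lin_ext f).
Proof.
move=> c x y; pose s := (msupp x `|` msupp y `|` msupp (c *: x + y))%fset.
have sx : (msupp x `<=` s)%fset by rewrite /s -fsetUA fsubsetUl.
have sy : (msupp y `<=` s)%fset.
  by rewrite /s [(msupp x `|` _)%fset]fsetUC -fsetUA fsubsetUl.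
rewrite (lin_extw f sx) (lin_extw f sy) (@lin_extw _ f _ s) ?fsubsetUr //.
rewrite scaler_sumr -big_split; apply: eq_bigr => p _ /=.
by rewrite mcoeffD mcoeffZ scalerDl scalerA.
Qed.

HB.instance Definition _ (V : lmodType k) (f : qpath Q -> V) :=
  GRing.isLinear.Build k kQ V _ (lin_ext f) (lin_ext_linear f).

Lemma path_algebraE (x : kQ) : x = lin_ext pbasis x.
Proof.
rewrite {1}[x]monalgE; apply: eq_bigr => p _; apply/malgP => q.
by rewrite mcoeffZ mcoeff_pbasis mcoeffU mulr_natr.
Qed.

Lemma kQ_ind (P : kQ -> Prop) :
  P 0 -> (forall c x y, P x -> P y -> P (c *: x + y)) ->
  (forall p, P (pbasis p)) -> forall x, P x.
Proof.
move=> P0 PD Pb x; rewrite [x]path_algebraE /lin_ext.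
by elim/big_rec: _ => // p y _ Py; apply: PD.
Qed.

(* Products of paths are written from right to left. *)
Definition pbasis_mul (p q : qpath Q) : kQ :=
  if pcomp p q is Some r then pbasis r else 0.

End PathAlgebra.

HB.lock Definition kQ_mul (k : fieldType) (Q : quiver) (x y : path_algebra k Q) :
  path_algebra k Q := lin_ext (fun p => lin_ext (pbasis_mul k p) y) x.

Section PathAlgebraRing.
Variables (k : fieldType) (Q : quiver).
Local Notation kQ := (path_algebra k Q).
Local Notation pbasis := (@pbasis k Q).
Local Notation kQ_mul := (@kQ_mul k Q).

Definition kQ_one : kQ := \sum_(v : vertex Q) pbasis (trivial_path v).

Lemma kQ_mulPl c x y z : kQ_mul (c *: x + y) z = c *: kQ_mul x z + kQ_mul y z.
Proof. by rewrite kQ_mul.unlock linearP. Qed.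

Lemma kQ_mulPr c x y z : kQ_mul z (c *: x + y) = c *: kQ_mul z x + kQ_mul z y.
Proof.
rewrite kQ_mul.unlock {1 3 5}/lin_ext scaler_sumr -big_split.
by apply: eq_bigr => p _ /=; rewrite linearP scalerDr !scalerA mulrC.
Qed.

Lemma kQ_mul0l z : kQ_mul 0 z = 0. Proof. by rewrite kQ_mul.unlock linear0. Qed.
Lemma kQ_mul0r z : kQ_mul z 0 = 0.
Proof. by have := kQ_mulPr 1 0 0 z; rewrite !scale1r addr0 -{1}[kQ_mul z 0]addr0 => /addrI. Qed.

Lemma kQ_mulZl c x y : kQ_mul (c *: x) y = c *: kQ_mul x y.
Proof. by rewrite -[in LHS](addr0 (c *: x)) kQ_mulPl kQ_mul0l addr0. Qed.

Lemma kQ_mulZr c x y : kQ_mul x (c *: y) = c *: kQ_mul x y.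
Proof. by rewrite -[in LHS](addr0 (c *: y)) kQ_mulPr kQ_mul0r addr0. Qed.

Lemma kQ_mul_basis p q : kQ_mul (pbasis p) (pbasis q) = pbasis_mul k p q.
Proof. by rewrite kQ_mul.unlock !lin_ext_basis. Qed.

(* Stated for an abstract product, which keeps unification from unfolding
   kQ_mul. *)
Lemma bilinear_assoc (m : kQ -> kQ -> kQ) :
  (forall c x y z, m (c *: x + y) z = c *: m x z + m y z) ->
  (forall c x y z, m z (c *: x + y) = c *: m z x + m z y) ->
  (forall x, m 0 x = 0) -> (forall x, m x 0 = 0) ->
  (forall p q r, m (pbasis p) (m (pbasis q) (pbasis r)) =
                 m (m (pbasis p) (pbasis q)) (pbasis r)) ->
  associative m.
Proof.
move=> mPl mPr m0l m0r mb x y z.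
elim/kQ_ind: x => [|c x x' Ex Ex'|p]; first by rewrite !m0l.
  by rewrite !mPl Ex Ex'.
elim/kQ_ind: y => [|c y y' Ey Ey'|q]; first by rewrite m0r !m0l m0r.
  by rewrite mPl !mPr mPl Ey Ey'.
elim/kQ_ind: z => [|c z z' Ez Ez'|r]; first by rewrite !m0r.
  by rewrite !mPr Ez Ez'.
exact: mb.
Qed.

Lemma kQ_mulA : associative kQ_mul.
Proof.
apply: (bilinear_assoc kQ_mulPl kQ_mulPr kQ_mul0l kQ_mul0r) => p q r.
rewrite (kQ_mul_basis q r) (kQ_mul_basis p q) /pbasis_mul.
have := pcompA p q r.
case: (pcomp q r) => [s|]; case: (pcomp p q) => [t|] /= E.
- by rewrite (kQ_mul_basis p s) (kQ_mul_basis t r) /pbasis_mul E.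
- by rewrite (kQ_mul_basis p s) (kQ_mul0l (pbasis r)) /pbasis_mul E.
- by rewrite (kQ_mul_basis t r) (kQ_mul0r (pbasis p)) /pbasis_mul -E.
- by rewrite (kQ_mul0l (pbasis r)) (kQ_mul0r (pbasis p)).
Qed.

Lemma kQ_mul1 : left_id kQ_one kQ_mul.
Proof.
move=> x; elim/kQ_ind: x => [|c x y Ex Ey|p]; first exact: kQ_mul0r.
  by rewrite kQ_mulPr Ex Ey.
rewrite /kQ_one kQ_mul.unlock linear_sum (bigD1 (ptgt p)) //= big1 ?addr0 => [|v nv].
  by rewrite !lin_ext_basis /pbasis_mul pcomp1p.
by rewrite !lin_ext_basis /pbasis_mul /pcomp eq_sym (negPf nv).
Qed.

Lemma kQ_1mul : right_id kQ_one kQ_mul.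
Proof.
move=> x; elim/kQ_ind: x => [|c x y Ex Ey|p]; first exact: kQ_mul0l.
  by rewrite kQ_mulPl Ex Ey.
rewrite /kQ_one kQ_mul.unlock lin_ext_basis linear_sum (bigD1 (psrc p)) //=.
rewrite big1 ?addr0 => [|v nv]; rewrite lin_ext_basis /pbasis_mul.
  by rewrite pcompp1.
by rewrite /pcomp (negPf nv).
Qed.

Lemma kQ_mulDl : left_distributive kQ_mul +%R.
Proof. by move=> x y z; have := kQ_mulPl 1 x y z; rewrite !scale1r. Qed.

Lemma kQ_mulDr : right_distributive kQ_mul +%R.
Proof. by move=> x y z; have := kQ_mulPr 1 y z x; rewrite !scale1r. Qed.

(* A pzRingType: the path algebra of the empty quiver is the zero ring. *)
HB.instance Definition _ := GRing.Zmodule_isPzRing.Build kQ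
  kQ_mulA kQ_mul1 kQ_1mul kQ_mulDl kQ_mulDr.

Lemma kQ_scalerAl c (x y : kQ) : c *: (x * y) = (c *: x) * y.
Proof. by rewrite -[RHS]/(kQ_mul _ _) kQ_mulZl. Qed.

Lemma kQ_scalerAr c (x y : kQ) : c *: (x * y) = x * (c *: y).
Proof. by rewrite -[RHS]/(kQ_mul _ _) kQ_mulZr. Qed.

Lemma pbasis_mulE p q :
  pbasis p * pbasis q = if pcomp p q is Some r then pbasis r else 0.
Proof. exact: kQ_mul_basis. Qed.

End PathAlgebraRing.

Section QuotientAlgebra.
Variables (k : fieldType) (Q : quiver) (S : set (path_algebra k Q)).
Local Notation kQ := (path_algebra k Q).
Local Notation I := (ideal_gen S).

Definition quotient_algebra : Type := Quotient.quot I.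
Local Notation L := quotient_algebra.

HB.instance Definition _ := GRing.Zmodule.on L.
HB.instance Definition _ := EqQuotient.on L.
HB.instance Definition _ := ZmodQuotient.on L.

Definition cls (x : kQ) : L := \pi x.

Lemma clsE x y : (cls x == cls y) = (x - y \in I).
Proof. by rewrite Quotient.idealrBE. Qed.

Lemma cls_repr (u : L) : cls (repr u) = u. Proof. exact: reprK. Qed.

Lemma clsB : zmod_morphism cls.
Proof. exact: pi_is_zmod_morphism. Qed.

HB.instance Definition _ := GRing.isZmodMorphism.Build kQ L cls clsB.

Definition quot_scale (c : k) (u : L) : L := cls (c *: repr u).
Definition quot_mul (u v : L) : L := cls (repr u * repr v).

Lemma ideal_genZ c x : x \in I -> c *: x \in I.
Proof. by move=> Ix; rewrite -[x]mul1r kQ_scalerAl ideal_genMl. Qed.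

Lemma cls_repr_ideal x : repr (cls x) - x \in I.
Proof. by rewrite -clsE cls_repr. Qed.

Lemma quot_scaleE c x : quot_scale c (cls x) = cls (c *: x).
Proof. by apply/eqP; rewrite clsE -scalerBr ideal_genZ // cls_repr_ideal. Qed.

Lemma quot_mulE x y : quot_mul (cls x) (cls y) = cls (x * y).
Proof.
apply/eqP; rewrite clsE -(subrKA (x * repr (cls y))) -mulrBl -mulrBr.
apply: ideal_genD; [apply: ideal_genMr|apply: ideal_genMl]; exact: cls_repr_ideal.
Qed.

Lemma quot_scaleA a b u : quot_scale a (quot_scale b u) = quot_scale (a * b) u.
Proof. by rewrite -[u]cls_repr !quot_scaleE scalerA. Qed.

Lemma quot_scale1 : left_id 1 quot_scale.
Proof. by move=> u; rewrite -[u]cls_repr quot_scaleE scale1r. Qed.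

Lemma quot_scaleDr : right_distributive quot_scale +%R.
Proof.
move=> a u v; rewrite -[u]cls_repr -[v]cls_repr.
by rewrite -raddfD !quot_scaleE scalerDr raddfD.
Qed.

Lemma quot_scaleDl u : {morph quot_scale^~ u : a b / a + b}.
Proof. by move=> a b; rewrite -[u]cls_repr !quot_scaleE scalerDl raddfD. Qed.

HB.instance Definition _ := GRing.Zmodule_isLmodule.Build k L
  quot_scaleA quot_scale1 quot_scaleDr quot_scaleDl.

Lemma quot_mulA : associative quot_mul.
Proof.
by move=> u v w; rewrite -[u]cls_repr -[v]cls_repr -[w]cls_repr !quot_mulE mulrA.
Qed.

Lemma quot_mul1 : left_id (cls 1) quot_mul.
Proof. by move=> u; rewrite -[u]cls_repr quot_mulE mul1r. Qed.

Lemma quot_1mul : right_id (cls 1) quot_mul.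
Proof. by move=> u; rewrite -[u]cls_repr quot_mulE mulr1. Qed.

Lemma quot_mulDl : left_distributive quot_mul +%R.
Proof.
move=> u v w; rewrite -[u]cls_repr -[v]cls_repr -[w]cls_repr.
by rewrite -raddfD !quot_mulE mulrDl raddfD.
Qed.

Lemma quot_mulDr : right_distributive quot_mul +%R.
Proof.
move=> u v w; rewrite -[u]cls_repr -[v]cls_repr -[w]cls_repr.
by rewrite -raddfD !quot_mulE mulrDr raddfD.
Qed.

HB.instance Definition _ := GRing.Zmodule_isPzRing.Build L
  quot_mulA quot_mul1 quot_1mul quot_mulDl quot_mulDr.

Lemma clsD : {morph cls : x y / x + y}.
Proof. exact: (raddfD (cls : {additive kQ -> L})). Qed.

Lemma clsZ c x : cls (c *: x) = c *: cls x.
Proof. exact/esym/quot_scaleE. Qed.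

Lemma clsM : {morph cls : x y / x * y}.
Proof. by move=> x y; apply/esym/quot_mulE. Qed.

Lemma cls_monoid_morphism : monoid_morphism cls.
Proof. by split=> //; apply: clsM. Qed.

HB.instance Definition _ := GRing.isScalable.Build k kQ L _ cls clsZ.
HB.instance Definition _ :=
  GRing.isMonoidMorphism.Build kQ L cls cls_monoid_morphism.

Lemma quot_scalerAl c (u v : L) : c *: (u * v) = (c *: u) * v.
Proof.
by rewrite -[u]cls_repr -[v]cls_repr -clsM -!clsZ -clsM kQ_scalerAl.
Qed.

Lemma quot_scalerAr c (u v : L) : c *: (u * v) = u * (c *: v).
Proof.
by rewrite -[u]cls_repr -[v]cls_repr -clsM -!clsZ -clsM kQ_scalerAr.
Qed.

Lemma cls_eq0 x : (cls x == 0) = (x \in I).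
Proof. by rewrite -(raddf0 cls) clsE subr0. Qed.

End QuotientAlgebra.

(* An oriented knot in 3-space, parametrized with period 1 and oriented by
   increasing parameter; [shadow] is its projection to the plane and [height]
   its third coordinate. *)
Record knot (R : realType) := Knot {
  shadow : R -> R * R;
  height : R -> R;
  shadow_continuous : continuous shadow;
  height_continuous : continuous height;
  shadow_periodic : forall t, shadow (t + 1) = shadow t;
  height_periodic : forall t, height (t + 1) = height t;
  knot_embedded : forall t u, 0 <= t < 1 -> 0 <= u < 1 ->
    shadow t = shadow u -> height t = height u -> t = u
}.

(* A knot whose projection to the plane is regular: finitely many multiple
   points, all of them transversal double points. Differentiability is required
   at the double points only, so both smooth and polygonal knots are covered.
   [times] enumerates the parameters in [0, 1[ of the passages through the
   crossings, in the order in which they are met along the orientation. *)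
Record knot_diagram (R : realType) := KnotDiagram {
  diagram_knot :> knot R;
  times : seq R;
  times_sorted : sorted <%R times;
  mem_times : forall t, t \in times <->
    0 <= t < 1 /\
    exists u, [/\ 0 <= u < 1, u != t & shadow diagram_knot u = shadow diagram_knot t];
  double_points : forall t u v,
    t \in times -> u \in times -> v \in times ->
    shadow diagram_knot t = shadow diagram_knot u ->
    shadow diagram_knot u = shadow diagram_knot v ->
    [|| t == u, u == v | t == v];
  double_derivable : forall t, t \in times ->
    derivable (fun s => (shadow diagram_knot s).1) t 1 /\
    derivable (fun s => (shadow diagram_knot s).2) t 1;
  transversal : forall t u,
    t \in times -> u \in times -> t != u ->
    shadow diagram_knot t = shadow diagram_knot u ->
    derive1 (fun s => (shadow diagram_knot s).1) t *
      derive1 (fun s => (shadow diagram_knot s).2) u !=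
    derive1 (fun s => (shadow diagram_knot s).1) u *
      derive1 (fun s => (shadow diagram_knot s).2) t
}.

Section KnotQuiver.
Variables (R : realType) (D : knot_diagram R).

(* Crossings are points of the plane. *)
Definition crossing : finType := seq_sub (map (shadow D) (times D)).
Definition passage : finType := seq_sub (times D).

Definition crossing_at (a : passage) : crossing :=
  SeqSub (map_f (shadow D) (ssvalP a)).

Lemma next_in_times (a : passage) : next (times D) (ssval a) \in times D.
Proof. by rewrite mem_next ssvalP. Qed.

Definition next_passage (a : passage) : passage := SeqSub (next_in_times a).

Definition over (a : passage) : bool :=
  [exists b : passage, (crossing_at b == crossing_at a) &&
                       (height D (ssval b) < height D (ssval a))].

(* A segment is represented by the passage at which it starts. *)
Definition knot_quiver : quiver :=
  @Quiver crossing passage crossing_at (crossing_at \o next_passage).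

(* [true] stands for positive, [false] for negative. *)
Definition src_sign (a : arrow knot_quiver) : bool := over a.
Definition tgt_sign (a : arrow knot_quiver) : bool := over (next_passage a).

Definition follow_up (p : qpath knot_quiver) : bool :=
  sorted (fun a b => tgt_sign a == src_sign b) (arrows p).

Lemma ex_source_arrow (e : crossing) (b : bool) :
  exists a : arrow knot_quiver, (src a == e) && (src_sign a == b).
Proof.
case: e => x xP; have /mapP[t tt xE] := xP.
have [t01 [u [u01 ut su]]] := (mem_times D t).1 tt.
have uu : u \in times D by apply/mem_times; split=> //; exists t; rewrite eq_sym.
have Ht : height D t != height D u.
  by apply: contra_neq ut => /esym; apply: knot_embedded.
pose T : passage := SeqSub tt; pose U : passage := SeqSub uu.
have cT : crossing_at T == SeqSub xP by rewrite -val_eqE /= xE.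
have cU : crossing_at U == SeqSub xP by rewrite -val_eqE /= su xE.
have third (W : passage) : crossing_at W == SeqSub xP -> W = T \/ W = U.
  rewrite -val_eqE /= xE => /eqP sW.
  have := double_points (ssvalP W) tt uu sW (esym su).
  by rewrite [t == u]eq_sym (negPf ut) /= => /orP[]/eqP h; [left|right]; apply: val_inj.
have key (A B : passage) : crossing_at A == SeqSub xP ->
    crossing_at B == SeqSub xP -> height D (ssval A) < height D (ssval B) ->
    (forall W, crossing_at W == SeqSub xP -> W = A \/ W = B) ->
    over B /\ ~~ over A.
  move=> /eqP cA /eqP cB lt all; split.
    by apply/existsP; exists A; rewrite cA cB eqxx.
  apply/existsP => -[W]; rewrite cA => /andP[/all[->|->]]; first by rewrite ltxx.
  by rewrite ltNge ltW.
have [A [B [cA cB oB oA]]] : exists A B : passage,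
    [/\ crossing_at A == SeqSub xP, crossing_at B == SeqSub xP,
        over B & ~~ over A].
  move: Ht; rewrite neq_lt => /orP[] lt.
    by have [] := key T U cT cU lt third; exists T, U.
  have third' W : crossing_at W == SeqSub xP -> W = U \/ W = T.
    by move=> /third[]; [right|left].
  by have [] := key U T cU cT lt third'; exists U, T.
case: b; first by exists B; rewrite cB /src_sign oB.
by exists A; rewrite cA /src_sign (negPf oA).
Qed.

Lemma ex_target_arrow (e : crossing) (b : bool) :
  exists a : arrow knot_quiver, (tgt a == e) && (tgt_sign a == b).
Proof.
have [a aP] := ex_source_arrow e b.
have pP : prev (times D) (ssval a) \in times D by rewrite mem_prev ssvalP.
exists (SeqSub pP); rewrite /tgt_sign /=.
suff -> : next_passage (SeqSub pP) = a by [].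
apply: val_inj; rewrite /= next_prev //.
exact: lt_sorted_uniq (times_sorted D).
Qed.

Definition source_arrow (e : crossing) (b : bool) : arrow knot_quiver :=
  xchoose (ex_source_arrow e b).

Definition target_arrow (e : crossing) (b : bool) : arrow knot_quiver :=
  xchoose (ex_target_arrow e b).

Lemma browse_subproof (a : arrow knot_quiver) n :
  composable (src a) (traject next_passage a n).
Proof. by elim: n a => //= n IHn a; rewrite eqxx IHn. Qed.

(* The path following up the segments from arrow a until arrow b, both
   included. *)
Definition browse (a b : arrow knot_quiver) : qpath knot_quiver :=
  QPath (qpath_val := (src a, traject next_passage a (findex next_passage a b).+1))
        (browse_subproof a _).

Definition alpha (e : crossing) : qpath knot_quiver :=
  browse (source_arrow e true) (target_arrow e false).

Definition beta (e : crossing) : qpath knot_quiver :=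
  browse (source_arrow e false) (target_arrow e true).

End KnotQuiver.

Section DiagramAlgebra.
Variables (k : fieldType) (R : realType) (D : knot_diagram R).
Local Notation kQ := (path_algebra k (knot_quiver D)).

Definition gamma_pos (e : crossing D) : kQ :=
  pbasis k (beta e) * pbasis k (alpha e).

Variable tau : vertex (knot_quiver D) -> k.

Definition typeI : set kQ := [set x | exists a b : arrow (knot_quiver D),
  [/\ tgt a = src b, tgt_sign a != src_sign b &
      x = pbasis k (arrow_path b) * pbasis k (arrow_path a)]].

Definition typeII : set kQ := [set x | exists e : vertex (knot_quiver D),
  x = pbasis k (alpha e) * pbasis k (beta e)
      - tau e *: (pbasis k (beta e) * pbasis k (alpha e))].

Definition diagram_algebra : Type := quotient_algebra (typeI `|` typeII)%classic.

HB.instance Definition _ := GRing.Lmodule.on diagram_algebra.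
HB.instance Definition _ := GRing.PzRing.on diagram_algebra.

Definition diagram_class : kQ -> diagram_algebra := @cls k _ (typeI `|` typeII)%classic.

End DiagramAlgebra.

(* Main.v *)
(* Every path is congruent modulo I_tau to a normal form: itself if it is a
   follow-up path that is shorter than n_D or a positive fundamental cycle, the
   multiple tau(e) gamma_e^+ if it is a negative fundamental cycle gamma_e^-, and
   0 otherwise. Indeed the diagram is a single closed curve, so a follow-up path
   is determined by its first arrow and its length, those of length n_D are the
   fundamental cycles, and a longer one is killed by exchanging gamma_e^+ and
   gamma_e^-, which creates a relation of type I.
   Conversely the linear extension of the normal form to kQ_D vanishes on I_tau,
   so it descends to the quotient and separates the classes of the normal
   paths. *)

Require Import Defs.
From mathcomp Require Import all_boot all_order all_algebra.
From mathcomp Require Import boolp classical_sets reals.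
From mathcomp Require Import -(notations) monalg.

Set Implicit Arguments.
Unset Strict Implicit.
Unset Printing Implicit Defensive.

Import Order.TTheory GRing.Theory.
Local Open Scope ring_scope.

(** Used to locate two consecutive arrows of a path at which it stops following the diagram. *)
Lemma unsorted_split (T : eqType) (e : rel T) (s : seq T) :
  ~~ sorted e s -> exists s1 a b s2, s = s1 ++ [:: a, b & s2] /\ ~~ e a b.
Proof.
elim: s => //= a [|b s] IHs //=; rewrite negb_and => /orP[nab|ns].
  by exists [::], a, b, s.
have [s1 [c [d [s2 [-> ncd]]]]] := IHs ns.
by exists (a :: s1), c, d, s2.
Qed.

(** * Bases indexed by a finite set *)

Section Bases.
Variables (k : fieldType) (V : lmodType k) (I : eqType) (b : I -> V).
Variables (T : seq I) (uT : uniq T) (fT : forall i, i \in T).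

Lemma basis_enum_free (c : I -> k) : is_basis b ->
  \sum_(i <- T) c i *: b i = 0 -> forall i, c i = 0.
Proof. by move=> [free _] c0 i; apply: free c0 _ (fT i). Qed.

Lemma enum_is_basis :
  (forall c : I -> k, \sum_(i <- T) c i *: b i = 0 -> forall i, c i = 0) ->
  (forall v, exists c : I -> k, v = \sum_(i <- T) c i *: b i) ->
  is_basis b.
Proof.
move=> free span; split=> [s c us sc0 i si|v]; last first.
  by have [c ->] := span v; exists T, c.
(* A relation supported on [s] is extended by zero to all of [T]. *)
have := free (fun j => if j \in s then c j else 0) _ i; rewrite si; apply.
rewrite -[RHS]sc0 (bigID (mem s)) /= [X in _ + X]big1 => [|j /negPf->]; last first.
  by rewrite scale0r.
rewrite addr0 -big_filter (perm_big s) /=; last first.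
  apply: uniq_perm; rewrite ?filter_uniq // => j.
  by rewrite mem_filter fT andbT.
by apply: eq_big_seq => j ->.
Qed.

Lemma basis_finite_dimensional : is_basis b -> finite_dimensional V.
Proof.
move=> bB; have [free span] := bB; pose n := size T; exists n.
pose f (r : 'rV[k]_n) : V := \sum_(j < n) r 0 j *: b (tnth (in_tuple T) j).
have f_lin : linear f.
  move=> c r r'; rewrite /f scaler_sumr -big_split; apply: eq_bigr => j _ /=.
  by rewrite !mxE scalerDl scalerA.
have fE (c : I -> k) : \sum_(i <- T) c i *: b i =
    f (\row_j c (tnth (in_tuple T) j)).
  rewrite /f -[T]/(tval (in_tuple T)) big_tuple.
  by apply: eq_bigr => j _; rewrite mxE.
have f_surj v : exists r, f r = v.
  have [s [c ->]] := span v.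
  (* The list [s] may repeat an index, so the coefficients of equal indices are added up. *)
  exists (\row_j \sum_(i <- s | i == tnth (in_tuple T) j) c i).
  rewrite -(fE (fun t => \sum_(i <- s | i == t) c i)).
  under eq_bigr => t _ do rewrite scaler_suml big_mkcond /=.
  rewrite exchange_big /=; apply: eq_bigr => i _.
  rewrite (bigD1_seq i) //= eqxx big1 ?addr0 // => t.
  by rewrite eq_sym => /negPf->.
have f_ker r : f r = 0 -> r = 0.
  move=> fr0; apply/rowP => j; rewrite mxE.
  (* This reads the row [r] as a function on indices; since [T] has no duplicates, each sum at an
     entry of [T] has a single term. *)
  pose c t := \sum_(l < n | tnth (in_tuple T) l == t) r 0 l.
  have cE l : c (tnth (in_tuple T) l) = r 0 l.
    rewrite /c (big_pred1 l) // => m; apply: inj_eq.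
    exact/tuple_uniqP.
  rewrite -cE; apply: basis_enum_free => //; rewrite fE -[RHS]fr0; congr f.
  by apply/rowP => l; rewrite mxE cE.
have f0 : f 0 = 0 by rewrite /f big1 // => j _; rewrite mxE scale0r.
have f_inj : injective f.
  move=> r r' e; apply/eqP; rewrite -subr_eq0; apply/eqP/f_ker.
  by have := f_lin (-1) r' r; rewrite !scaleN1r e addNr addrC.
have [g gK] := choice f_surj; constructor; exists g.
  by move=> c v w; apply: f_inj; rewrite f_lin !gK.
by exists f => // r; apply: f_inj; rewrite gK.
Qed.

End Bases.

(** A partial inverse of [f], chosen classically, pulls the enumeration of [F] back to [I]. *)
Lemma finite_enumeration (I : eqType) (F : finType) (f : I -> F) :
  injective f -> exists T : seq I, uniq T /\ forall i, i \in T.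
Proof.
move=> f_inj.
have [g gP] : exists g : F -> option I, forall i, g (f i) = Some i.
  exists (fun y => if pselect (exists i, f i = y) is left h
                   then Some (projT1 (cid h)) else None) => i.
  case: pselect => [h|[]]; last by exists i.
  by congr Some; apply: f_inj; rewrite (projT2 (cid h)).
exists (undup (pmap g (enum F))); split=> [|i]; first exact: undup_uniq.
by rewrite mem_undup mem_pmap -gP map_f // mem_enum.
Qed.

(** * Passages along the diagram and follow-up paths *)

Section Passages.
Variables (R : realType) (D : knot_diagram R).
Local Notation nxt := (@next_passage R D).
(* Unqualified, [over] is now ssreflect's. *)
Local Notation over := (@Defs.over R D).

Lemma times_uniq : uniq (times D).
Proof. exact: lt_sorted_uniq (times_sorted D). Qed.

Lemma next_passage_inj : injective nxt.
Proof.
move=> a b /(congr1 val) /= /(can_inj (prev_next times_uniq)) h.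
exact: val_inj.
Qed.

Lemma card_passage_gt0 (a : passage D) : (0 < #|passage D|)%N.
Proof. by apply/card_gt0P; exists a. Qed.

(** This is where the diagram having one component enters: all passages lie on a single cycle of the
    successor map. *)
Lemma passages_cycle : exists p : seq (passage D),
  [/\ fcycle nxt p, uniq p & forall a, a \in p].
Proof.
pose p : seq (passage D) := pmap insub (times D).
have pE : map val p = times D.
  by rewrite (pmap_filter (insubK _)); apply/all_filterP/allP => t tt; rewrite /= insubT.
exists p; split.
- have := cycle_next times_uniq; rewrite -{2}pE cycle_map.
  by rewrite (eq_cycle (e' := frel nxt)).
- by rewrite -(map_inj_uniq val_inj) pE times_uniq.
- by move=> a; rewrite -(mem_map val_inj) pE ssvalP.
Qed.

Lemma next_connect a b : fconnect nxt a b.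
Proof. by have [p [cp _ pT]] := passages_cycle; rewrite (fconnect_cycle cp). Qed.

Lemma order_next a : order nxt a = #|passage D|.
Proof. by apply: eq_card => b; rewrite !inE next_connect. Qed.

Lemma iter_next_card a : iter #|passage D| nxt a = a.
Proof. by rewrite -(order_next a) iter_order //; apply: next_passage_inj. Qed.

Lemma iter_next_small a i :
  (0 < i < #|passage D|)%N -> iter i nxt a != a.
Proof.
case/andP=> i0; rewrite -(order_next a) => /findex_iter iE.
by apply: contraTneq i0 => ia; rewrite -iE ia findex0.
Qed.

(** A crossing is only a double point, and its two passages have different heights because the knot
    is embedded; hence exactly one of them is over. *)
Lemma over_inj (a b : passage D) :
  crossing_at a = crossing_at b -> over a = over b -> a = b.
Proof.
move=> cab oab; apply: contra_eq (oab) => nab.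
have nv : ssval a != ssval b by rewrite val_eqE.
have [a01 _] := (mem_times D _).1 (ssvalP a).
have [b01 _] := (mem_times D _).1 (ssvalP b).
have sab : shadow D (ssval a) = shadow D (ssval b) by have := congr1 val cab.
have : height D (ssval a) != height D (ssval b).
  by apply: contra_neq nv; apply: knot_embedded.
have key (x y : passage D) : crossing_at x = crossing_at y -> ssval x != ssval y ->
    (height D (ssval x) < height D (ssval y))%R -> over x != over y.
  move=> cxy nxy lt.
  have -> : over y by apply/existsP; exists x; rewrite cxy eqxx.
  (* A passage [w] below [x] at this crossing would be [x] itself or the higher passage [y]. *)
  rewrite eqb_id; apply/existsP => -[w /andP[/eqP cw hw]].
  have := @double_points _ D _ _ _ (ssvalP w) (ssvalP x) (ssvalP y)
    (congr1 val cw) (congr1 val cxy).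
  rewrite (negPf nxy) /= => /orP[]/eqP wE; rewrite wE in hw.
    by rewrite ltxx in hw.
  by have := lt_trans lt hw; rewrite ltxx.
rewrite neq_lt => /orP[] lt; first exact: key.
by rewrite eq_sym; apply: key; rewrite // eq_sym.
Qed.

Lemma source_arrowE (e : crossing D) s :
  crossing_at (source_arrow e s) = e /\ over (source_arrow e s) = s.
Proof. by have /andP[/eqP ? /eqP ?] := xchooseP (ex_source_arrow e s). Qed.

Lemma source_arrow_over (a : passage D) : source_arrow (crossing_at a) (over a) = a.
Proof. by have [c o] := source_arrowE (crossing_at a) (over a); apply: over_inj. Qed.

Lemma next_target_arrow (e : crossing D) s :
  nxt (target_arrow e s) = source_arrow e s.
Proof.
have [c o] := source_arrowE e s; apply: over_inj; rewrite ?c ?o.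
  by have /andP[/eqP + _] := xchooseP (ex_target_arrow e s).
by have /andP[_ /eqP] := xchooseP (ex_target_arrow e s).
Qed.

(** For [m = 0] this is the trivial path at the source of [a]; [m] is unbounded, so the path may go
    around the diagram several times. *)
Definition fpath (a : arrow (knot_quiver D)) (m : nat) : qpath (knot_quiver D) :=
  QPath (qpath_val := (src a, traject nxt a m)) (browse_subproof a m).

Lemma psrc_fpath (a : passage D) m : psrc (fpath a m) = crossing_at a.
Proof. by []. Qed.

Lemma ptgt_fpath (a : passage D) m : ptgt (fpath a m) = crossing_at (iter m nxt a).
Proof. by rewrite /ptgt /psrc /arrows /=; elim: m a => //= m IHm a; rewrite IHm -iterSr. Qed.

Lemma plength_fpath a m : plength (fpath a m) = m.
Proof. exact: size_traject. Qed.

Lemma follow_up_fpath a m : follow_up (fpath a m).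
Proof.
rewrite /follow_up /arrows /=; case: m => //= m.
by elim: m a => //= m IHm a; rewrite IHm andbT /tgt_sign /src_sign.
Qed.

(** Each arrow forces the next one: the crossing and the sign determine the passage by
    [over_inj]. *)
Lemma follow_upP (p : qpath (knot_quiver D)) :
  follow_up p -> (0 < plength p)%N -> exists a, p = fpath a (plength p).
Proof.
case: p => -[v [|a s]] //= pP; rewrite /follow_up /plength /arrows /= => fs _.
exists a; apply: val_inj => /=; have /andP[/eqP <- sP] := pP; congr (_, _ :: _).
elim: s a {v pP} fs sP => [|b s IHs] a //= /andP[/eqP ab fs] /andP[/eqP cb sP].
have nab : nxt a = b by apply: over_inj.
by rewrite nab -(IHs b fs sP).
Qed.

(** Travelling both paths in turn leads back to the starting passage, so the total length is a
    multiple of the period; as each length lies strictly between 0 and the period, the total is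
    exactly one period. *)
Lemma alpha_beta_length e : exists i j,
  [/\ (i + j)%N = #|passage D|,
      alpha e = fpath (source_arrow e true) i, beta e = fpath (source_arrow e false) j,
      iter i nxt (source_arrow e true) = source_arrow e false &
      iter j nxt (source_arrow e false) = source_arrow e true].
Proof.
have main s : exists i, [/\ (0 < i < #|passage D|)%N,
    browse (source_arrow e s) (target_arrow e (~~ s)) = fpath (source_arrow e s) i &
    iter i nxt (source_arrow e s) = source_arrow e (~~ s)].
  set a := source_arrow e s; set b := target_arrow e _.
  exists (findex nxt a b).+1.
  have E : iter (findex nxt a b).+1 nxt a = source_arrow e (~~ s).
    by rewrite iterS iter_findex ?next_connect // next_target_arrow.
  (* The length is at most the period, and not equal to it: a full turn would end at [a], whose sign
     is opposite to that of the passage reached. *)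
  split=> //=; rewrite ltn_neqAle -{2}(order_next a) findex_max ?next_connect // andbT.
  apply: contra_eqN E => /eqP->; rewrite iter_next_card.
  apply/eqP => /(congr1 over).
  by have [_ ->] := source_arrowE e s; have [_ ->] := source_arrowE e (~~ s); case: (s).
have [i [/andP[i0 ilt] iE iI]] := main true; have [j [/andP[j0 jlt] jE jI]] := main false.
exists i, j; split=> //.
have : iter (j + i) nxt (source_arrow e true) = source_arrow e true by rewrite iterD iI.
have [lt|gt|<-] := ltngtP (j + i)%N #|passage D|; last by rewrite addnC.
  by move/eqP; rewrite (negPf (iter_next_small _ _)) // addn_gt0 j0.
rewrite -(subnK (ltnW gt)) iterD iter_next_card => /eqP.
rewrite (negPf (iter_next_small _ _)) // subn_gt0 gt /= ltn_subLR ?(ltnW gt) //.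
by rewrite -addnS leq_add // ltnW.
Qed.

End Passages.

(** * Products of paths *)

Section PathProducts.
Variables (k : fieldType) (Q : quiver).
Local Notation pbasis := (@pbasis k Q).

Lemma pbasis_mul_cat p q r : ptgt q = psrc p ->
  qpath_val r = (psrc q, arrows q ++ arrows p) ->
  pbasis p * pbasis q = pbasis r.
Proof.
move=> e rE; rewrite pbasis_mulE; have [s -> sE] := pcompP e.
by congr pbasis; apply: val_inj; rewrite /= sE.
Qed.

Lemma pbasis_mul_eq0 p q : ptgt q != psrc p -> pbasis p * pbasis q = 0.
Proof. by move=> ne; rewrite pbasis_mulE /Defs.pcomp (negPf ne). Qed.

(** Serves to evaluate the normal form on two-sided multiples of the generators of the ideal. *)
Lemma pbasis_mul3 p g q :
  if (ptgt q == psrc g) && (ptgt g == psrc p) then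
    exists2 r, pbasis p * pbasis g * pbasis q = pbasis r &
               qpath_val r = (psrc q, arrows q ++ arrows g ++ arrows p)
  else pbasis p * pbasis g * pbasis q = 0.
Proof.
have [e1|n1] := eqVneq (ptgt q) (psrc g); last first.
  by rewrite -mulrA [pbasis g * _]pbasis_mul_eq0 // mulr0.
have [e2|n2] := eqVneq (ptgt g) (psrc p); last first.
  by rewrite pbasis_mul_eq0 // mul0r.
have [s _ sE] := pcompP e2.
have e3 : ptgt q = psrc s by rewrite e1 /psrc sE.
have [r _ rE] := pcompP e3; exists r.
  by rewrite (pbasis_mul_cat e2 sE) (pbasis_mul_cat e3 rE).
by rewrite rE [arrows s]/arrows sE.
Qed.

Lemma pbasis_split (r : qpath Q) s1 s2 : arrows r = s1 ++ s2 ->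
  exists p q, [/\ arrows p = s2, arrows q = s1 & pbasis r = pbasis p * pbasis q].
Proof.
case: r => -[v s] rP; rewrite {1}/arrows /= => sE.
have : composable v (s1 ++ s2) by rewrite -sE.
rewrite composable_cat => /andP[P1 P2].
exists (@QPath _ (last v (map tgt s1), s2) P2), (@QPath _ (v, s1) P1); split=> //.
by apply/esym/pbasis_mul_cat; rewrite //= sE.
Qed.

Lemma arrow_pathE (p : qpath Q) a : arrows p = [:: a] -> p = arrow_path a.
Proof.
case: p => -[v s] pP; rewrite /arrows /= => sE; apply: val_inj => /=.
have : composable v [:: a] by rewrite -sE.
by rewrite sE /= andbT => /eqP->.
Qed.

Lemma composable_arrows (p : qpath Q) : composable (psrc p) (arrows p).
Proof. exact: (qpath_valP p). Qed.

End PathProducts.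

Lemma solve_scaled_sub (k : fieldType) (V : lmodType k) (c : k) (x y : V) :
  c != 0 -> y - c^-1 *: x = - c^-1 *: (x - c *: y).
Proof. by move=> c0; rewrite scalerBr scalerA mulNr mulVf // scaleN1r opprK scaleNr addrC. Qed.

Lemma mem_ideal_gen (A : pzRingType) (S : set A) x : S x -> x \in ideal_gen S.
Proof.
move=> Sx; apply/asboolP; exists 1%N, (fun=> 1), (fun=> x), (fun=> 1).
by split=> //; rewrite big_ord1 mul1r mulr1.
Qed.

(** * Normal forms modulo the ideal *)

Section NormalForm.
Variables (k : fieldType) (R : realType) (D : knot_diagram R).
Variables (tau : vertex (knot_quiver D) -> k) (tau_neq0 : forall e, tau e != 0).
Local Notation Q := (knot_quiver D).
Local Notation kQ := (path_algebra k Q).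
Local Notation pbasis := (@pbasis k Q).
Local Notation nxt := (@next_passage R D).
Local Notation over := (@Defs.over R D).
Local Notation n := #|arrow Q|.
Local Notation I := (ideal_gen (typeI (k := k) (D := D) `|` typeII tau)%classic).

Lemma pbasis_fpathD a i j :
  pbasis (fpath a (i + j)) = pbasis (fpath (iter i nxt a) j) * pbasis (fpath a i).
Proof. by apply/esym/pbasis_mul_cat; rewrite ?ptgt_fpath //= trajectD. Qed.

Lemma gamma_posE e : gamma_pos k e = pbasis (fpath (source_arrow e true) n).
Proof.
have [i [j [ijn aE bE iE jE]]] := alpha_beta_length e.
by rewrite -[n]ijn pbasis_fpathD iE -aE -bE.
Qed.

Lemma gamma_negE e : pbasis (alpha e) * pbasis (beta e) =
  pbasis (fpath (source_arrow e false) n).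
Proof.
have [i [j [ijn aE bE iE jE]]] := alpha_beta_length e.
by rewrite -[n]ijn addnC pbasis_fpathD jE -aE -bE.
Qed.

Lemma typeI_mem (a b : arrow Q) : tgt a = src b -> tgt_sign a != src_sign b ->
  pbasis (arrow_path b) * pbasis (arrow_path a) \in I.
Proof. by move=> ab sab; apply: mem_ideal_gen; left; exists a, b. Qed.

Lemma typeII_mem e : pbasis (fpath (source_arrow e false) n)
  - tau e *: pbasis (fpath (source_arrow e true) n) \in I.
Proof.
by apply: mem_ideal_gen; right; exists e; rewrite -gamma_negE -gamma_posE.
Qed.

Lemma not_follow_up_mem p : ~~ follow_up p -> pbasis p \in I.
Proof.
(* The consecutive arrows [a], [b] with clashing signs are cut out as a factor of type I. *)
move=> /unsorted_split[s1 [a [b [s2 [pE ab]]]]].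
have [r2 [q1 [r2E _ ->]]] := pbasis_split k pE; apply: ideal_genMr.
have := composable_arrows r2; rewrite r2E /= => /and3P[_ /eqP tab _].
have [r3 [qa [r3E /arrow_pathE-> ->]]] := @pbasis_split k _ r2 [:: a] _ r2E.
have [r4 [qb [_ /arrow_pathE-> ->]]] := @pbasis_split k _ r3 [:: b] _ r3E.
by rewrite -mulrA ideal_genMl // typeI_mem.
Qed.

(* The path u goes once around and ends on the strand of u, so that the arrow
   a of the other strand cannot follow up. *)
Lemma fpath_turn (a u : passage D) : a != u -> crossing_at a = crossing_at u ->
  pbasis (fpath a 1) * pbasis (fpath u n) \in I.
Proof.
move=> au cau; have nE : (n.-1 + 1)%N = n.
  by rewrite addn1 prednK // (card_passage_gt0 a).
have iE : nxt (iter n.-1 nxt u) = u.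
  by rewrite -iterS -addn1 nE iter_next_card.
rewrite -nE pbasis_fpathD mulrA ideal_genMr //.
rewrite (@arrow_pathE _ (fpath a 1) a) // (@arrow_pathE _ (fpath _ 1) (iter n.-1 nxt u)) //.
apply: typeI_mem; rewrite /= ?iE // /tgt_sign /src_sign iE.
by apply: contra_neq au => oau; apply: over_inj.
Qed.

(** The two turns are the fundamental cycles at the crossing. The scalar is [tau] if [a] is the
    under-passage and its inverse otherwise, which uses that [tau] does not vanish. *)
Lemma fpath_exchange (a u : passage D) : a != u -> crossing_at a = crossing_at u ->
  exists c, pbasis (fpath a n) - c *: pbasis (fpath u n) \in I.
Proof.
move=> au cau; have oau : over u = ~~ over a.
  have : over u != over a by apply: contra_neq au => oau; apply: over_inj.
  by case: (over u); case: (over a).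
have := typeII_mem (crossing_at a).
have := source_arrow_over a; have := source_arrow_over u; rewrite oau -cau.
case: (over a) => /= -> ->; last by exists (tau (crossing_at a)).
set x := pbasis _; set y := pbasis _; set t := tau _; exists t^-1.
rewrite (solve_scaled_sub x y (tau_neq0 _)).
exact: ideal_genZ.
Qed.

(* A path of length n + 1 is a full turn from a, followed by a; exchanging that
   turn for the one along the other strand makes the last step a turn. *)
Lemma long_fpath_mem a m : (n < m)%N -> pbasis (fpath a m) \in I.
Proof.
move=> nm; rewrite -(subnKC nm) pbasis_fpathD ideal_genMl //.
rewrite -addn1 pbasis_fpathD iter_next_card.
pose u := source_arrow (crossing_at a) (~~ over a).
have [] := source_arrowE (crossing_at a) (~~ over a); rewrite -/u => cu ou.
have au : a != u.
  by apply: contra_eqN ou => /eqP <-; case: (over a).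
have [c h] := fpath_exchange au (esym cu).
rewrite -[pbasis (fpath a n)](subrK (c *: pbasis (fpath u n))) mulrDr.
apply: ideal_genD; first exact: ideal_genMl.
by rewrite -kQ_scalerAr; apply/ideal_genZ/fpath_turn.
Qed.

(* [true] on trivial paths, which makes them normal without appealing to n > 0. *)
Definition starts_over (p : qpath Q) : bool :=
  if arrows p is a :: _ then src_sign a else true.

Definition normal_form (p : qpath Q) : kQ :=
  if follow_up p && (plength p <= n)%N then
    if (plength p == n) && ~~ starts_over p
    then tau (psrc p) *: pbasis (fpath (source_arrow (psrc p) true) n)
    else pbasis p
  else 0.

Lemma starts_over_fpath a m : (0 < m)%N -> starts_over (fpath a m) = over a.
Proof. by case: m. Qed.

Lemma normal_form_cong p : pbasis p - normal_form p \in I.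
Proof.
rewrite /normal_form; have [fp|nfp] := boolP (follow_up p); last first.
  by rewrite subr0 not_follow_up_mem.
have [p0|p0] := posnP (plength p).
  by rewrite /starts_over (size0nil p0) andbF p0 subrr ideal_gen0.
have [a ->] := follow_upP fp p0; rewrite plength_fpath psrc_fpath /=.
have [pn|np] := leqP; last by rewrite subr0 long_fpath_mem.
(* From here on the length is at most [n]; only a full turn starting under differs from its normal
   form, and it does so by a type II relation. *)
rewrite starts_over_fpath //; case: eqP => [->|_] /=; last by rewrite subrr ideal_gen0.
have := source_arrow_over a; case: (over a) => aE /=; first by rewrite subrr ideal_gen0.
by have := typeII_mem (crossing_at a); rewrite aE.
Qed.

Lemma normal_form_full a : normal_form (fpath a n) =
  if over a then pbasis (fpath a n) else tau (crossing_at a) *: gamma_pos k (crossing_at a).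
Proof.
rewrite /normal_form follow_up_fpath plength_fpath leqnn eqxx gamma_posE.
by rewrite starts_over_fpath ?(card_passage_gt0 a) //; case: (over a).
Qed.

Lemma normal_form_eq0 p : ~~ follow_up p || (n < plength p)%N -> normal_form p = 0.
Proof. by rewrite /normal_form ltnNge -negb_and => /negPf->. Qed.

Lemma normal_form_short p : follow_up p -> (plength p < n)%N ->
  normal_form p = pbasis p.
Proof. by move=> fp pn; rewrite /normal_form fp ltnW // ltn_eqF. Qed.

Lemma normal_form_gamma_pos e :
  normal_form (fpath (source_arrow e true) n) = gamma_pos k e.
Proof.
by have [_ o] := source_arrowE e true; rewrite normal_form_full o gamma_posE.
Qed.

Lemma normal_form_gamma_neg e :
  normal_form (fpath (source_arrow e false) n) = tau e *: gamma_pos k e.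
Proof.
have [c o] := source_arrowE e false.
by rewrite normal_form_full o c.
Qed.

(** The clash of signs survives inside any longer path, so a nonzero product is a path that is not a
    follow-up path. *)
Lemma normal_form_typeI p q x : typeI x -> lin_ext normal_form (pbasis p * x * pbasis q) = 0.
Proof.
move=> [a [b [tab sab ->]]].
have gP : composable (src a) [:: a; b] by rewrite /= eqxx andbT; apply/eqP/esym.
rewrite (@pbasis_mul_cat _ _ _ _ (@QPath Q (src a, [:: a; b]) gP)) //.
have := pbasis_mul3 k p (@QPath Q (src a, [:: a; b]) gP) q.
case: ifP => _ [] => [r -> rE|->]; last exact: linear0.
rewrite lin_ext_basis normal_form_eq0 // /follow_up /arrows rE /=.
by rewrite sorted_cat_cons /= (negPf sab) !andbF.
Qed.

(* Multiplied by a path of positive length, both terms get longer than n. *)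
Lemma normal_form_typeII p q x : typeII tau x ->
  lin_ext normal_form (pbasis p * x * pbasis q) = 0.
Proof.
move=> [e ->]; rewrite gamma_negE -/(gamma_pos k e) gamma_posE.
set u := source_arrow e false; set a := source_arrow e true.
have [ca _] := source_arrowE e true; have [cu _] := source_arrowE e false.
rewrite mulrBr mulrBl -kQ_scalerAr -kQ_scalerAl linearB linearZ /=.
have := pbasis_mul3 k p (fpath u n) q; have := pbasis_mul3 k p (fpath a n) q.
rewrite !ptgt_fpath !psrc_fpath !iter_next_card ca cu.
case: ifP => [/andP[/eqP qe /eqP pe]|_ -> ->]; last by rewrite linear0 scaler0 subr0.
move=> [r -> rE] [s -> sE]; rewrite !lin_ext_basis.
have [long|] := boolP (n < plength r)%N.
  rewrite !normal_form_eq0 ?long ?orbT ?scaler0 ?subr0 //.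
  move: long; rewrite /plength /arrows rE sE /= !size_cat !size_traject.
  by move=> ->; rewrite orbT.
(* Otherwise [p] and [q] are trivial, and the two fundamental cycles themselves remain. *)
rewrite -leqNgt {1}/plength {1}/arrows rE /= !size_cat size_traject.
rewrite addnCA -{2}[n]addn0 leq_add2l leqn0 addn_eq0 !size_eq0.
move=> /andP[/eqP q0 /eqP p0].
have qe' : psrc q = e by rewrite -qe /ptgt q0.
have -> : r = fpath a n by apply: val_inj; rewrite /= rE q0 p0 cats0 qe' ca.
have -> : s = fpath u n by apply: val_inj; rewrite /= sE q0 p0 cats0 qe' cu.
by rewrite normal_form_gamma_neg normal_form_gamma_pos subrr.
Qed.

Lemma normal_form_ideal x : x \in I -> lin_ext normal_form x = 0.
Proof.
move=> /asboolP[m [l [g [r [Sg ->]]]]]; rewrite linear_sum big1 // => i _.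
move: (l i) (g i) (r i) (Sg i) => {}l {}g {}r {}Sg.
(* By bilinearity the two outer factors may be taken to be paths. *)
elim/kQ_ind: l => [|c y z Ey Ez|p]; first by rewrite !mul0r linear0.
  by rewrite !mulrDl -!kQ_scalerAl linearP /= Ey Ez scaler0 addr0.
elim/kQ_ind: r => [|c y z Ey Ez|q]; first by rewrite mulr0 linear0.
  by rewrite mulrDr -kQ_scalerAr linearP /= Ey Ez scaler0 addr0.
by case: Sg => [/normal_form_typeI|/normal_form_typeII]; apply.
Qed.

End NormalForm.

(** * The basis of the diagram algebra *)

Section DiagramClass.
Variables (k : fieldType) (R : realType) (D : knot_diagram R).
Variables (tau : vertex (knot_quiver D) -> k) (tau_neq0 : forall e, tau e != 0).
Local Notation Q := (knot_quiver D).
Local Notation kQ := (path_algebra k Q).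
Local Notation pbasis := (@pbasis k Q).
Local Notation n := #|arrow Q|.
Local Notation I := (ideal_gen (typeI (k := k) (D := D) `|` typeII tau)%classic).
Local Notation class := (diagram_class tau).

Lemma diagram_class_eq0 x : (class x == 0) = (x \in I).
Proof. exact: cls_eq0. Qed.

Lemma diagram_class_linear c x y : class (c *: x + y) = c *: class x + class y.
Proof. by rewrite /diagram_class clsD clsZ. Qed.

Lemma diagram_class0 : class 0 = 0.
Proof. by apply/eqP; rewrite diagram_class_eq0 ideal_gen0. Qed.

Lemma diagram_class_sum (J : Type) (s : seq J) (c : J -> k) (x : J -> kQ) :
  class (\sum_(i <- s) c i *: x i) = \sum_(i <- s) c i *: class (x i).
Proof.
elim: s => [|i s IHs]; first by rewrite !big_nil diagram_class0.
by rewrite !big_cons diagram_class_linear IHs.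
Qed.

Lemma diagram_class_normal_form p : class (pbasis p) = class (normal_form tau p).
Proof. by apply/eqP; rewrite -[_ == _]/(cls _ _ == cls _ _) clsE normal_form_cong. Qed.

(** A short follow-up path is its own normal form, hence nonzero, whereas the normal form vanishes
    on the ideal. *)
Lemma short_class_eq0 p : (plength p < n)%N ->
  (class (pbasis p) == 0) = ~~ follow_up p.
Proof.
move=> pn; rewrite diagram_class_eq0; apply/idP/idP; last exact: not_follow_up_mem.
move=> /normal_form_ideal; apply: contra_eqN => fp.
rewrite lin_ext_basis normal_form_short //.
by apply/eqP => /(congr1 (mcoeff p))/eqP; rewrite mcoeff_pbasis mcoeff0 eqxx oner_eq0.
Qed.

Local Notation basis_index :=
  (vertex Q + {p : qpath Q | (plength p < n)%N && (class (pbasis p) != 0)})%type.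

(** Representing each positive fundamental cycle by a single path makes all basis elements paths
    fixed by the normal form. *)
Definition basis_path (i : basis_index) : qpath Q :=
  match i with inl e => fpath (source_arrow e true) n | inr p => val p end.

Lemma basis_path_short p : (plength (basis_path (inr p)) < n)%N.
Proof. by have /andP[] := valP p. Qed.

Lemma basis_path_inj : injective basis_path.
Proof.
have srcE e : psrc (basis_path (inl e)) = e.
  by rewrite psrc_fpath; have [] := source_arrowE e true.
move=> [e|p] [f|q].
- by move=> /(congr1 (@psrc Q)); rewrite !srcE => ->.
- by move=> pE; have := basis_path_short q; rewrite -pE plength_fpath ltnn.
- by move=> pE; have := basis_path_short p; rewrite pE plength_fpath ltnn.
- by move=> /val_inj->.
Qed.

Lemma normal_form_basis_path i : normal_form tau (basis_path i) = pbasis (basis_path i).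
Proof.
case: i => [e|p]; first by rewrite normal_form_gamma_pos gamma_posE.
have /andP[pn] := valP p; rewrite short_class_eq0 // negbK => fp.
exact: normal_form_short.
Qed.

(** A path is determined by its starting vertex and its arrows, here at most [n] of them, so
    [insub_bseq] never truncates; the vertex is what separates the trivial paths. *)
Lemma basis_index_enumeration : exists T : seq basis_index, uniq T /\ forall i, i \in T.
Proof.
pose f i := (psrc (basis_path i), insub_bseq n (arrows (basis_path i))).
apply: (@finite_enumeration _ _ f) => i j [eqs eqa].
apply/basis_path_inj/val_inj.
have le l : (size (arrows (basis_path l)) <= n)%N.
  case: l => [e|p]; first by rewrite -/(plength _) plength_fpath.
  exact: ltnW (basis_path_short p).
have := congr1 val eqa; rewrite /= !val_insubd !le => eqa'.
by rewrite [LHS]surjective_pairing [RHS]surjective_pairing; congr (_, _).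
Qed.

Lemma basis_path_is_basis : is_basis (fun i : basis_index => class (pbasis (basis_path i))).
Proof.
have [T [uT fT]] := basis_index_enumeration; apply: (enum_is_basis uT fT) => [c c0 i|v].
  have /normal_form_ideal : \sum_(j <- T) c j *: pbasis (basis_path j) \in I.
    by rewrite -diagram_class_eq0 diagram_class_sum c0.
  (* The normal form fixes the distinct paths of the family, so the coefficient at the [i]-th path
     is [c i]. *)
  rewrite linear_sum => /(congr1 (mcoeff (basis_path i))).
  rewrite mcoeff0 raddf_sum (bigD1_seq i) //= big1 ?addr0 => [|j ji].
    by rewrite linearZ /= lin_ext_basis normal_form_basis_path mcoeffZ mcoeff_pbasis eqxx mulr1.
  rewrite linearZ /= lin_ext_basis normal_form_basis_path mcoeffZ mcoeff_pbasis.
  by rewrite (inj_eq basis_path_inj) (negPf ji) mulr0.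
pose in_span u := exists c : basis_index -> k,
  u = \sum_(i <- T) c i *: class (pbasis (basis_path i)).
have span0 : in_span 0.
  by exists (fun=> 0); rewrite big1 // => i _; rewrite scale0r.
have spanP a u u' : in_span u -> in_span u' -> in_span (a *: u + u').
  move=> [c ->] [c' ->]; exists (fun i => a * c i + c' i).
  rewrite scaler_sumr -big_split; apply: eq_bigr => i _ /=.
  by rewrite scalerDl scalerA.
have spanB i : in_span (class (pbasis (basis_path i))).
  exists (fun j => (j == i)%:R); rewrite (bigD1_seq i) //= eqxx scale1r big1 ?addr0 //.
  by move=> j /negPf->; rewrite scale0r.
suff spanT x : in_span (class x) by rewrite -[v]cls_repr; apply: spanT.
elim/kQ_ind: x => [|c x y Ex Ey|p]; first by rewrite diagram_class0.
  by rewrite diagram_class_linear; apply: spanP.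
(* It remains to span the normal forms: zero, short follow-up paths, and multiples of positive
   fundamental cycles. *)
rewrite diagram_class_normal_form /normal_form.
case: ifP => [/andP[fp]|_]; last by rewrite diagram_class0.
rewrite leq_eqVlt => /orP[/eqP pn|pn]; last first.
  rewrite ltn_eqF //=.
  have pP : (plength p < n)%N && (class (pbasis p) != 0).
    by rewrite pn short_class_eq0 ?negbK.
  exact: spanB (inr (exist _ p pP)).
have spanG e := spanB (inl e); rewrite pn eqxx /=.
case: ifP => [_|/negbFE so].
  rewrite -[_ *: _]addr0 diagram_class_linear diagram_class0.
  by apply: spanP => //; apply: spanG.
(* A full turn starting over is the positive fundamental cycle at its source. *)
suff -> : p = fpath (source_arrow (psrc p) true) n by exact: spanG.
have n0 := card_passage_gt0 (source_arrow (psrc p) true).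
have [|a pE] := follow_upP fp; first by rewrite pn.
rewrite pn in pE; move: so; rewrite pE psrc_fpath starts_over_fpath // => oa.
by rewrite -[X in source_arrow _ X]oa source_arrow_over.
Qed.

End DiagramClass.

Theorem proposition2p6 (k : fieldType) (R : realType) (D : knot_diagram R)
    (D_crossing : (0 < #|crossing D|)%N)
    (tau : vertex (knot_quiver D) -> k) (tau_neq0 : forall e, tau e != 0) :
  let n_D := #|arrow (knot_quiver D)| in
  let path_class (p : qpath (knot_quiver D)) := diagram_class tau (pbasis k p) in
  [/\ finite_dimensional (diagram_algebra tau),
      is_basis (fun i : vertex (knot_quiver D) +
          {p : qpath (knot_quiver D) | (plength p < n_D)%N && (path_class p != 0)} =>
        match i with
        | inl e => diagram_class tau (gamma_pos k e)
        | inr p => path_class (val p)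
        end) &
      forall p : qpath (knot_quiver D), (plength p < n_D)%N ->
        path_class p != 0 <-> follow_up p].
Proof.
move=> n_D path_class; set b := (X in is_basis X).
have bE : b = fun i => diagram_class tau (pbasis k (basis_path i)).
  by apply/funext => -[e|//]; rewrite /b gamma_posE.
have bB : is_basis b by rewrite bE; apply: basis_path_is_basis.
split=> // [|p pn]; last by rewrite short_class_eq0 ?negbK.
have [T [uT fT]] := basis_index_enumeration tau.
exact: basis_finite_dimensional uT fT bB.
Qed.
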